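(* Let $p\ge5$ be a prime with $\left(\frac{-10}{p}\right)=-1$. Then for all integers $\alpha\ge1$ and $n\ge0$, \[ b_5\!\left(4 p^{2\alpha}n+\frac{(24i+7p)p^{2\alpha-1}-1}{6}\right)\equiv 0 \pmod 2 \] for each $i=1,2,\ldots,p-1$.
   Context: For a positive integer $\ell$, $b_\ell(n)$ denotes the number of partitions of $n$ having no part divisible by $\ell$. $\left(\frac{a}{p}\right)$ is the Legendre symbol. *)

(* Defs.v *)
From mathcomp Require Import all_boot all_order all_algebra.
Set Implicit Arguments. Unset Strict Implicit. Unset Printing Implicit Defensive.
Import Order.TTheory GRing.Theory Num.Theory.

(* A partition of n is encoded by its multiplicity function m on {0,...,n}:
   m i = number of parts equal to i (i >= 1), with sum_i i * m i = n.
   (Each multiplicity is at most n, so 'I_n.+1 values suffice; index 0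
   carries multiplicity 0.)  b_ell(n) counts those with no part divisible by
   ell, i.e. m i = 0 whenever ell divides i (this also forces m 0 = 0). *)
Definition b (ell n : nat) : nat :=
  #|[set m : {ffun 'I_n.+1 -> 'I_n.+1} |
      ((\sum_(i < n.+1) i * m i)%N == n) &&
      [forall i : 'I_n.+1, (ell %| i) ==> (m i == ord0)]]|.

Definition legendre (a : int) (p : nat) : int :=
  if (p%:Z %| a)%Z then 0%R
  else if [exists x : 'I_p, (p%:Z %| ((x%:Z) ^+ 2 - a)%R)%Z] then 1%R else (-1)%R.

(* Main.v *)
(* Work with power series modulo 2, truncated modulo X^K, and write f_d for the
   product of the 1 - X^(dk).  Then f_2 = f_1^2, and G = f_5 / f_1 generates b_5.
   The Jacobi triple product (from the q-binomial theorem) gives, modulo 2,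
   f_1^3 = psi, the theta series of the exponents 2r^2 - r, and also
   f_1 f_5 = theta_{5,1} theta_{5,2}.  Counting Gaussian integers of given norm
   according to their class modulo a prime above 5 yields
     psi(X)^2 = theta_{5,1} theta_{5,2} + X psi(X^5)^2,
   that is f_1 f_5 = f_1^6 + X f_5^6.  Hence G = f_1^4 + X f_5^4 G^2, and iterating,
     G = f_1^4 + X (f_5 f_1^2)^4 + X^3 (f_5^3 G)^4,
   so b_5(4M + 1) has the parity of the coefficient of X^M in f_5 f_1^2.  By Euler's
   pentagonal theorem, if it is odd then 24M + 7 = 2x^2 + 5y^2 for some x and y.
   As -10 is not a square modulo p, the p-adic valuation of such a form is even,
   whereas here 24M + 7 is p^(2 alpha - 1) times a unit. *)
Require Import Defs.
From mathcomp Require Import all_boot all_order all_algebra.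
From mathcomp Require Import zify ring.
Set Implicit Arguments. Unset Strict Implicit. Unset Printing Implicit Defensive.
Import Order.TTheory GRing.Theory Num.Theory.

(** * Power series modulo ['X^K], modelled by polynomials *)

Section TruncatedCongruence.
Local Open Scope ring_scope.
Variable R : comNzRingType.
Implicit Types (p q r : {poly R}) (K : nat).

Definition eqmodX K p q := forall i, (i < K)%N -> p`_i = q`_i.

Lemma eqmodX_refl K p : eqmodX K p p.
Proof. by []. Qed.

Lemma eqmodX_sym K p q : eqmodX K p q -> eqmodX K q p.
Proof. by move=> pq i /pq. Qed.

Lemma eqmodX_trans K q p r : eqmodX K p q -> eqmodX K q r -> eqmodX K p r.
Proof. by move=> pq qr i iK; rewrite pq ?qr. Qed.

Lemma eqmodX_le K L p q : (K <= L)%N -> eqmodX L p q -> eqmodX K p q.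
Proof. by move=> KL pq i iK; apply: pq; apply: leq_trans KL. Qed.

Lemma eqmodXD K p p' q q' :
  eqmodX K p p' -> eqmodX K q q' -> eqmodX K (p + q) (p' + q').
Proof. by move=> hp hq i iK; rewrite !coefD hp ?hq. Qed.

Lemma eqmodXM K p p' q q' :
  eqmodX K p p' -> eqmodX K q q' -> eqmodX K (p * q) (p' * q').
Proof.
move=> hp hq i iK; rewrite !coefM; apply: eq_bigr => j _.
by rewrite hp ?hq //; apply: leq_ltn_trans iK; rewrite ?leq_subr // -ltnS.
Qed.

Lemma eqmodXX K n p q : eqmodX K p q -> eqmodX K (p ^+ n) (q ^+ n).
Proof. by move=> pq; elim: n => // n IH; rewrite !exprS; apply: eqmodXM. Qed.

Lemma eqmodX_sum K I (s : seq I) (P : pred I) (f g : I -> {poly R}) :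
  (forall i, P i -> eqmodX K (f i) (g i)) ->
  eqmodX K (\sum_(i <- s | P i) f i) (\sum_(i <- s | P i) g i).
Proof. by move=> fg; apply: (big_ind2 (eqmodX K)) => // *; apply: eqmodXD. Qed.

Lemma eqmodX_prod K I (s : seq I) (P : pred I) (f g : I -> {poly R}) :
  (forall i, P i -> eqmodX K (f i) (g i)) ->
  eqmodX K (\prod_(i <- s | P i) f i) (\prod_(i <- s | P i) g i).
Proof. by move=> fg; apply: (big_ind2 (eqmodX K)) => // *; apply: eqmodXM. Qed.

(** Constant coefficient 1 makes [r] invertible as a power series: the top term of each convolution
    is the coefficient itself, and the lower ones agree by strong induction. *)
Lemma eqmodX_cancel K r p q :
  r`_0 = 1 -> eqmodX K (p * r) (q * r) -> eqmodX K p q.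
Proof.
move=> r0 pq i; elim/ltn_ind: i => i IH iK.
have := pq i iK; rewrite !coefM !big_ord_recr /= subnn r0 !mulr1.
rewrite (eq_bigr (fun j : 'I_i => q`_j * r`_(i - j))); first by move/addrI.
by move=> j _; rewrite IH // (ltn_trans _ iK).
Qed.

Lemma eqmodX_comp K d p q : (0 < d)%N ->
  eqmodX K p q -> eqmodX K (p \Po 'X^d) (q \Po 'X^d).
Proof.
move=> d0 pq i iK; rewrite !coef_comp_poly_Xn //; case: ifP => // _.
by apply: pq; apply: leq_ltn_trans iK; apply: leq_div.
Qed.

Lemma eqmodX_mulXn K d p q :
  eqmodX K p q -> eqmodX (d + K) ('X^d * p) ('X^d * q).
Proof. by move=> pq i iK; rewrite !coefXnM; case: ifP => // ?; apply: pq; lia. Qed.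

Lemma eqmodX_subXn K d : (K <= d)%N -> eqmodX K (1 - 'X^d) 1.
Proof.
by move=> Kd i iK; rewrite coefB coefXn ltn_eqF ?subr0 // (leq_trans iK).
Qed.

End TruncatedCongruence.

(** * Gaussian binomials and the q-binomial theorem *)

Section GaussianBinomial.
Local Open Scope ring_scope.
Variable R : comNzRingType.
Implicit Types t x y : R.

Fixpoint qbin t m j : R :=
  match m, j with
  | _, 0 => 1
  | 0, _.+1 => 0
  | m'.+1, j'.+1 => qbin t m' j' + t ^+ j'.+1 * qbin t m' j'.+1
  end.

(** The q-Pochhammer symbol (t; t)_m; at [t = 'X^d] it is a partial product of f_d. *)
Definition qfact t m := \prod_(k < m) (1 - t ^+ k.+1).

Lemma qbin0 t m : qbin t m 0 = 1.
Proof. by case: m. Qed.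

Lemma qbin_small t m j : (m < j)%N -> qbin t m j = 0.
Proof.
elim: m j => [|m IH] [|j] //= mj.
by rewrite !IH ?mulr0 ?addr0 //; apply: leqW.
Qed.

Lemma qfactS t m : qfact t m.+1 = qfact t m * (1 - t ^+ m.+1).
Proof. by rewrite /qfact big_ord_recr. Qed.

(** Pascal's recurrence reduces this to (1 - t^(j+1)) + t^(j+1) (1 - t^(m-j)) = 1 - t^(m+1). *)
Lemma qbin_fact t m j : (j <= m)%N ->
  qbin t m j * qfact t j * qfact t (m - j) = qfact t m.
Proof.
have q0 : qfact t 0 = 1 by rewrite /qfact big_ord0.
elim: m j => [|m IH] [|j] jm //; rewrite ?qbin0 ?subn0 ?q0 ?mul1r //.
rewrite subSS /= mulrDl mulrDl.
have -> : qbin t m j * qfact t j.+1 * qfact t (m - j) =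
          qfact t m * (1 - t ^+ j.+1).
  by rewrite -(IH j jm) qfactS; ring.
move: jm; rewrite ltnS leq_eqVlt => /orP [/eqP ->|jm].
  by rewrite qbin_small // mulr0 !mul0r addr0 qfactS.
have -> : t ^+ j.+1 * qbin t m j.+1 * qfact t j.+1 * qfact t (m - j) =
          qfact t m * (t ^+ j.+1 * (1 - t ^+ (m - j))).
  rewrite -(IH j.+1 jm); have -> : (m - j = (m - j.+1).+1)%N by lia.
  by rewrite (qfactS t (m - j.+1)); ring.
rewrite qfactS -mulrDr; congr (_ * _).
by rewrite mulrBr -exprD mulr1 addSn subnKC 1?ltnW //; ring.
Qed.

(** Induction with [x] free: removing the first factor y + x replaces x by x t in the rest. *)
Lemma qbinomial_theorem t x y m :
  \prod_(k < m) (y + x * t ^+ k) =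
  \sum_(j < m.+1) t ^+ 'C(j, 2) * qbin t m j * x ^+ j * y ^+ (m - j).
Proof.
elim: m x => [|m IH] x; first by rewrite big_ord0 big_ord1 /=; ring.
rewrite big_ord_recl /= mulr1.
under eq_bigr => k _ do rewrite /bump /= add1n exprS mulrA.
rewrite IH mulrDl.
have -> : y * (\sum_(j < m.+1)
     t ^+ 'C(j, 2) * qbin t m j * (x * t) ^+ j * y ^+ (m - j)) =
   \sum_(j < m.+2) t ^+ ('C(j, 2) + j) * qbin t m j * x ^+ j * y ^+ (m.+1 - j).
  rewrite [RHS]big_ord_recr /= qbin_small // mulr0 !mul0r addr0 mulr_sumr.
  apply: eq_bigr => j _; rewrite subSn -1?ltnS // exprMn exprD exprS; ring.
rewrite big_ord_recl [RHS]big_ord_recl /= -addrA; congr (_ + _).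
  by rewrite !qbin0 addn0.
rewrite mulr_sumr -big_split /=; apply: eq_bigr => j _.
rewrite /bump /= !add1n subSS exprMn.
by rewrite (binS j 1) bin1 !exprD !exprS; ring.
Qed.

End GaussianBinomial.

(** * Theta series and the finite triple product *)

Section Theta.
Local Open Scope ring_scope.

(* The exponent b * r(r-1)/2 + c * r, which is nonnegative when c <= b. *)
Definition theta_exp (b c : nat) (r : int) : nat :=
  absz ((b%:Z * (r * (r - 1)) %/ 2)%Z + c%:Z * r).

Lemma consecutive_even (r : int) : exists h : int, r * (r - 1) = 2 * h.
Proof.
have [k [->|->]] : exists k : int, r = 2 * k \/ r = 2 * k + 1.
  by exists (r %/ 2)%Z; lia.
  by exists (k * (2 * k - 1)); ring.
by exists (k * (2 * k + 1)); ring.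
Qed.

Lemma theta_expE b c (r : int) : (c <= b)%N ->
  2 * (theta_exp b c r)%:Z = b%:Z * (r * (r - 1)) + 2 * c%:Z * r.
Proof.
move=> cb; rewrite /theta_exp.
have [h hE] := consecutive_even r.
have -> : b%:Z * (r * (r - 1)) = (b%:Z * h) * 2 by rewrite hE; ring.
rewrite mulzK // gez0_abs; first by ring.
have [d ->] : exists d, b = (c + d)%N by exists (b - c)%N; lia.
have h0 : 0 <= h by nia.
have hr0 : 0 <= h + r by nia.
rewrite PoszD; nia.
Qed.

(** With b = c + d, twice the exponent is c r(r+1) + d r(r-1) >= 2 r^2. Hence [int_range n] contains
    every r of exponent at most n. *)
Lemma theta_exp_ge b c (r : int) : (0 < c < b)%N -> (absz r <= theta_exp b c r)%N.
Proof.
move=> /andP [c0 cb]; have := theta_expE r (ltnW cb).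
have [d d0 ->] : exists2 d, (0 < d)%N & b = (c + d)%N by exists (b - c)%N; lia.
rewrite PoszD; nia.
Qed.

Definition int_range (n : nat) : seq int :=
  [seq k%:Z - n%:Z | k <- iota 0 (2 * n).+1].

Lemma mem_int_range n (r : int) : (r \in int_range n) = (absz r <= n)%N.
Proof.
apply/mapP/idP => [[k]|rn]; first by rewrite mem_iota => kn ->; lia.
by exists (absz (r + n%:Z)); rewrite ?mem_iota; lia.
Qed.

Lemma int_range_uniq n : uniq (int_range n).
Proof. by rewrite map_inj_uniq ?iota_uniq // => i j /addIr []. Qed.

Variable R : comNzRingType.

Definition theta n b c : {poly R} := \sum_(r <- int_range n) 'X^(theta_exp b c r).

Definition theta_prod n b c : {poly R} :=
  \prod_(k < n) ((1 + 'X^(b * k + c)) * (1 + 'X^(b * k + (b - c)))).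

(** This is the q-binomial theorem with 2n factors at t = X^b, x = 1, y = X^(bn-c), up to a power of
    X: the first n factors give the exponents bk + (b-c), the last n give bk + c. *)
Lemma finite_triple_product n b c : (0 < c < b)%N ->
  theta_prod n b c = \sum_(j < (2 * n).+1)
    qbin 'X^b (2 * n) j * 'X^(theta_exp b c (j%:Z - n%:Z)).
Proof.
move=> /andP [c0 cb].
(* [D] collects X^(bk) from each factor k < n and X^(bn-c) from each of the other n. *)
pose D := (\sum_(k < n) b * k + n * (b * n - c))%N.
have Xinj : injective (GRing.mul ('X^D : {poly R})).
  by move=> p q; apply: monic_lreg; rewrite monicXn.
apply: Xinj.
have := @qbinomial_theorem {poly R} 'X^b 1 'X^(b * n - c) (2 * n).
under eq_bigr => k _ do rewrite mul1r -exprM.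
have -> : \prod_(k < 2 * n) ('X^(b * n - c) + 'X^(b * k)) =
          'X^D * theta_prod n b c.
  have -> : (2 * n = n + n)%N by lia.
  rewrite big_split_ord /= (reindex_inj rev_ord_inj) /=.
  rewrite -big_split /=.
  rewrite /theta_prod /D exprD.
  have -> : (\sum_(k < n) b * k = \sum_(k < n) b * (n - k.+1))%N.
    by rewrite (reindex_inj rev_ord_inj).
  rewrite expr_sum [(n * _)%N]mulnC exprM.
  have -> : 'X^(b * n - c) ^+ n = \prod_(k < n) 'X^(b * n - c) :> {poly R}.
    by rewrite prodr_const card_ord.
  rewrite -!big_split /=; apply: eq_bigr => k _.
  have kn := ltn_ord k.
  have -> : 'X^(b * n - c) = 'X^(b * (n - k.+1)) * 'X^(b * k + (b - c)) :> {poly R}.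
    by rewrite -exprD; congr ('X^_); nia.
  have -> : 'X^(b * (n + k)) = 'X^(b * (n - k.+1)) * 'X^(b * k + (b - c))
       * 'X^(b * k + c) :> {poly R}.
    by rewrite -!exprD; congr ('X^_); nia.
  ring.
move=> ->; rewrite mulr_sumr; apply: eq_bigr => j _.
rewrite expr1n mulr1 -!exprM mulrAC -exprD mulrC [RHS]mulrCA -exprD; congr (_ * 'X^_).
have jn := ltn_ord j.
suff : (2 * (b * 'C(j, 2) + (b * n - c) * (2 * n - j)) =
        2 * (D + theta_exp b c (j%:Z - n%:Z)))%N by lia.
have E2 : (2 * 'C(j, 2) = j * (j - 1))%N.
  by rewrite bin2; have := odd_double_half (j * j.-1); rewrite oddM; case: (nat_of_ord j) => [|m] //=; lia.
have SD : (2 * \sum_(k < n) b * k = b * (n * (n - 1)))%N.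
  elim: (n) => [|m IH]; first by rewrite big_ord0 !muln0.
  by rewrite big_ord_recr /= mulnDr IH; nia.
have Ee := theta_expE (j%:Z - n%:Z) (ltnW cb).
rewrite /D; move: (theta_exp _ _ _) (\sum_(k < n) b * k)%N 'C(j, 2) Ee SD E2 => e S B.
(* At n = 0 the natural subtraction [b * n - c] truncates, so this case is separate. *)
move: (nat_of_ord j) jn => {}j jn; case: n jn {D} => [|m] jn Ee SD E2.
  move: Ee SD E2; have -> : j = 0%N by lia.
  by rewrite subrr mul0r !mulr0 => Ee SD E2; nia.
have [w wE] : exists w, (b * m.+1 = w + c)%N by exists (b * m.+1 - c)%N; nia.
have [v vE] : exists v, (2 * m.+1 = v + j)%N by exists (2 * m.+1 - j)%N; lia.
rewrite wE vE !addnK.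
have {E2} E2 : 2 * B%:Z = j%:Z * (j%:Z - 1).
  by move: E2; case: (j) => [|i]; rewrite ?subn1 /=; nia.
have {SD} SD : 2 * S%:Z = b%:Z * (m.+1%:Z * (m.+1%:Z - 1)).
  by move: SD; rewrite subn1 /=; nia.
have {}wE : w%:Z = b%:Z * m.+1%:Z - c%:Z by lia.
have {}vE : v%:Z = 2 * m.+1%:Z - j%:Z by lia.
suff : 2 * (b%:Z * B%:Z + w%:Z * v%:Z) = 2 * (S%:Z + m.+1%:Z * w%:Z + e%:Z) :> int.
  by lia.
rewrite !mulrDr SD Ee [2 * (b%:Z * _)]mulrCA E2 wE vE; ring.
Qed.
End Theta.

(** * The limit of the triple product *)

Section TripleProduct.
Local Open Scope ring_scope.
Variable R : comNzRingType.

Lemma qfact_coef0 b m : (0 < b)%N -> (qfact ('X^b : {poly R}) m)`_0 = 1.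
Proof.
move=> b0; elim: m => [|m IH]; first by rewrite /qfact big_ord0 coefC.
rewrite qfactS coefM big_ord1 subnn IH mul1r coefB -exprM coefXn coefC /=.
by rewrite ltn_eqF ?subr0 // muln_gt0 b0.
Qed.

Lemma qfact_stable b K m m' : (K <= b * m.+1)%N -> (K <= b * m'.+1)%N ->
  eqmodX K (qfact ('X^b : {poly R}) m) (qfact 'X^b m').
Proof.
suff H i d : (K <= b * i.+1)%N ->
    eqmodX K (qfact ('X^b : {poly R}) (i + d)) (qfact 'X^b i).
  move=> Km Km'; apply: eqmodX_trans (eqmodX_sym (H m m' Km)) _.
  by rewrite addnC; apply: H.
move=> Ki; elim: d => [|d IH]; first by rewrite addn0.
rewrite addnS qfactS -[X in eqmodX _ _ X]mulr1; apply: eqmodXM => //.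
by rewrite -exprM; apply: eqmodX_subXn; nia.
Qed.

(** In [qbin_fact] both [qfact] factors agree with [qfact 'X^b m] to this precision, and one copy
    cancels. *)
Lemma qbin_qfact b m j : (0 < b)%N -> (j <= m)%N ->
  eqmodX (minn j (m - j)) (qbin ('X^b : {poly R}) m j * qfact 'X^b m) 1.
Proof.
move=> b0 jm; apply: (@eqmodX_cancel _ _ (qfact 'X^b m)); first exact: qfact_coef0.
rewrite mul1r -[X in eqmodX _ _ X](@qbin_fact _ _ _ j) //.
apply: eqmodXM; last by apply: qfact_stable; nia.
by apply: eqmodXM => //; apply: qfact_stable; nia.
Qed.

Lemma triple_product n b c : (0 < c < b)%N ->
  eqmodX n (qfact 'X^b n * theta_prod R n b c) (theta R n b c).
Proof.
move=> cb; have b0 : (0 < b)%N by lia.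
apply: (@eqmodX_trans _ _ (qfact 'X^b (2 * n) * theta_prod R n b c)).
  by apply: eqmodXM => //; apply: qfact_stable; nia.
rewrite finite_triple_product // /theta /int_range big_map.
rewrite -[iota 0 _]/(index_iota 0 (2 * n).+1) big_mkord mulr_sumr.
apply: eqmodX_sum => j _; have jn := ltn_ord j.
have := theta_exp_ge (j%:Z - n%:Z) cb; set e := theta_exp _ _ _ => eE.
rewrite mulrC mulrAC mulrC -[X in eqmodX _ _ X]mulr1.
(* The binomial is only known to precision n - |j - n|; the factor ['X^e] with e >= |j - n| makes up
   the loss. *)
apply: (@eqmodX_le _ _ (e + minn j (2 * n - j))); first by lia.
by apply: eqmodX_mulXn; apply: qbin_qfact; rewrite // -ltnS.
Qed.

Lemma qfact_comp d K : (0 < d)%N ->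
  qfact ('X : {poly R}) K \Po 'X^d = qfact 'X^d K.
Proof.
move=> d0; rewrite /qfact rmorph_prod /=; apply: eq_bigr => k _.
by rewrite rmorphB rmorph1 /= comp_Xn_poly.
Qed.

End TripleProduct.

(** * Product formulas over F_2 *)

Section ModTwo.
Local Open Scope ring_scope.
Notation polyF2 := {poly 'F_2}.

Lemma pcharF2 : 2 \in [pchar polyF2].
Proof. by rewrite pchar_poly pchar_Fp. Qed.

Lemma oppF2 (p : polyF2) : - p = p.
Proof. exact: oppr_pchar2 pcharF2 p. Qed.

(** Frobenius is additive and fixes the coefficients in F_2. *)
Lemma sqrF2 (p : polyF2) : p ^+ 2 = p \Po 'X^2.
Proof.
elim/poly_ind: p => [|p c IH]; first by rewrite expr0n comp_poly0.
rewrite comp_polyD comp_polyM comp_polyX comp_polyC -IH.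
have -> : (p * 'X + c%:P) ^+ 2 = p ^+ 2 * 'X^2 + (c ^+ 2)%:P.
  rewrite rmorphXn /= -(pFrobenius_autE pcharF2) pFrobenius_autD_comm; last exact: mulrC.
  by rewrite !pFrobenius_autE exprMn.
by congr (_ + _%:P); apply: val_inj; case: c => [[|[|c]]].
Qed.

Lemma expF2_4 (p : polyF2) : p ^+ 4 = p \Po 'X^4.
Proof. have -> : p ^+ 4 = (p ^+ 2) ^+ 2 by rewrite -exprM.
have X4 : ('X^2 : polyF2) \Po 'X^2 = 'X^4 by rewrite comp_Xn_poly -exprM.
by rewrite (sqrF2 (p ^+ 2)) (sqrF2 p) -comp_polyA X4. Qed.

(** As 1 + X^k = 1 - X^k here, the factors just run through the residue classes modulo 3; the next
    two lemmas sort classes modulo 4 and 5 in the same way. *)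
Lemma theta_prod3 n :
  qfact 'X^3 n * theta_prod 'F_2 n 3 1 = qfact 'X (3 * n).
Proof.
rewrite /theta_prod; elim: n => [|n IH]; first by rewrite /qfact !big_ord0 mulr1.
rewrite mulnSr addn3 !qfactS -IH big_ord_recr /= -!exprM !oppF2.
have -> : (3 * n + 1 = (3 * n).+1)%N by lia.
have -> : (3 * n + (3 - 1) = (3 * n).+2)%N by lia.
have -> : (3 * n.+1 = (3 * n).+3)%N by lia.
ring.
Qed.

Lemma theta_prod4 n :
  theta_prod 'F_2 n 4 1 * qfact 'X^2 (2 * n) = qfact 'X (4 * n).
Proof.
rewrite /theta_prod; elim: n => [|n IH]; first by rewrite /qfact !big_ord0 mulr1.
have -> : (2 * n.+1 = (2 * n).+2)%N by lia.
have -> : (4 * n.+1 = (4 * n).+4)%N by lia.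
rewrite !qfactS -IH big_ord_recr /= -!exprM !oppF2.
have -> : (4 * n + 1 = (4 * n).+1)%N by lia.
have -> : (4 * n + (4 - 1) = (4 * n).+3)%N by lia.
have -> : (2 * (2 * n).+1 = (4 * n).+2)%N by lia.
have -> : (2 * (2 * n).+2 = (4 * n).+4)%N by lia.
ring.
Qed.

Lemma theta_prod5 n :
  qfact 'X^5 n * (theta_prod 'F_2 n 5 1 * theta_prod 'F_2 n 5 2) = qfact 'X (5 * n).
Proof.
rewrite /theta_prod; elim: n => [|n IH]; first by rewrite /qfact !big_ord0 !mulr1.
have -> : (5 * n.+1 = (5 * n).+1.+4)%N by lia.
rewrite !qfactS -IH !big_ord_recr /= -!exprM !oppF2.
have -> : (5 * n + 1 = (5 * n).+1)%N by lia.
have -> : (5 * n + (5 - 1) = (5 * n).+4)%N by lia.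
have -> : (5 * n + 2 = (5 * n).+2)%N by lia.
have -> : (5 * n + (5 - 2) = (5 * n).+3)%N by lia.
have -> : (5 * n.+1 = (5 * n).+1.+4)%N by lia.
ring.
Qed.

Variable K : nat.
Let P : polyF2 := qfact 'X K.
Let P5 : polyF2 := qfact 'X^5 K.

Lemma qfactX_stable m : (K <= m)%N -> eqmodX K (qfact 'X m) P.
Proof. by move=> Km; rewrite -['X]expr1; apply: qfact_stable; lia. Qed.

(** Pentagonal number theorem: the exponents are (3r^2 - r)/2. *)
Lemma euler_theta : eqmodX K P (theta 'F_2 K 3 1).
Proof.
apply: (eqmodX_trans _ (@triple_product 'F_2 K 3 1 isT)); rewrite theta_prod3.
by apply/eqmodX_sym/qfactX_stable; lia.
Qed.

(** After multiplication by f_2 = f_1^2, both sides become f_4 f_1 = f_1^5. *)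
Lemma jacobi_theta : eqmodX K (P ^+ 3) (theta 'F_2 K 4 1).
Proof.
apply: (eqmodX_trans _ (@triple_product 'F_2 K 4 1 isT)).
apply: (@eqmodX_cancel _ _ (qfact 'X^2 K)); first exact: qfact_coef0.
apply: (@eqmodX_trans _ _ (qfact 'X^4 K * (theta_prod 'F_2 K 4 1 * qfact 'X^2 (2 * K)))).
  rewrite theta_prod4 -!qfact_comp // -sqrF2 -expF2_4 -/P.
  have -> : P ^+ 3 * P ^+ 2 = P ^+ 4 * P by ring.
  by apply: eqmodXM => //; apply/eqmodX_sym/qfactX_stable; lia.
rewrite -mulrA; apply: eqmodXM => //; apply: eqmodXM => //.
by apply: qfact_stable; lia.
Qed.

Lemma theta5_product :
  eqmodX K (P * P5) (theta 'F_2 K 5 1 * theta 'F_2 K 5 2).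
Proof.
apply: (@eqmodX_trans _ _ ((qfact 'X^5 K * theta_prod 'F_2 K 5 1) *
   (qfact 'X^5 K * theta_prod 'F_2 K 5 2))); last first.
  by apply: eqmodXM; apply: triple_product.
have -> : (qfact 'X^5 K * theta_prod 'F_2 K 5 1) *
   (qfact 'X^5 K * theta_prod 'F_2 K 5 2) = qfact 'X (5 * K) * P5.
  by rewrite -theta_prod5 /P5; ring.
by apply: eqmodXM => //; apply/eqmodX_sym/qfactX_stable; lia.
Qed.

End ModTwo.

(** * Counting Gaussian integers of given norm *)

Section Counting.
Local Open Scope ring_scope.

Lemma count_bij (T U : eqType) (s : seq T) (t : seq U) (P : pred T) (Q : pred U)
    (g : T -> U) :
  uniq s -> uniq t ->
  (forall x, x \in s -> P x -> (g x \in t) && Q (g x)) ->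
  (forall x y, P x -> P y -> g x = g y -> x = y) ->
  (forall y, y \in t -> Q y -> exists x, [/\ x \in s, P x & g x = y]) ->
  count P s = count Q t.
Proof.
move=> us ut gPQ ginj gsurj; rewrite -!size_filter -(size_map g).
apply: perm_size; apply: uniq_perm; last 1 first.
- move=> y; rewrite mem_filter; apply/mapP/andP => [[x]|[Qy /gsurj]].
    by rewrite mem_filter => /andP [Px sx] ->; have /andP[] := gPQ x sx Px.
  by case/(_ Qy) => x [sx Px <-]; exists x; rewrite // mem_filter Px.
- rewrite map_inj_in_uniq ?filter_uniq // => x y.
  by rewrite !mem_filter => /andP [Px _] /andP [Py _]; apply: ginj.
- exact: filter_uniq.
Qed.

Lemma count_split (T : Type) (P Q : pred T) (s : seq T) :
  count P s = (count (predI P Q) s + count (predI P (predC Q)) s)%N.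
Proof. by elim: s => //= x s ->; case: (P x) (Q x) => [] []; lia. Qed.

Lemma coef_pair_sum (R : comNzRingType) (T U : Type) (s : seq T) (t : seq U)
    (e : T -> nat) (f : U -> nat) k :
  ((\sum_(x <- s) 'X^(e x)) * (\sum_(y <- t) 'X^(f y)) : {poly R})`_k =
  (count (fun z => e z.1 + f z.2 == k)%N [seq (x, y) | x <- s, y <- t])%:R.
Proof.
rewrite -sum1_count natr_sum [RHS]big_mkcond big_allpairs_dep /= mulr_suml coef_sum.
apply: eq_bigr => x _; rewrite mulr_sumr coef_sum; apply: eq_bigr => y _.
by rewrite -exprD coefXn eq_sym; case: eqP.
Qed.

Definition int_box n := [seq (r, s) | r <- int_range n, s <- int_range n].

Lemma int_box_uniq n : uniq (int_box n).
Proof. by apply: allpairs_uniq; rewrite ?int_range_uniq // => -[? ?] [? ?]. Qed.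

Lemma mem_int_box n (z : int * int) :
  (z \in int_box n) = (absz z.1 <= n)%N && (absz z.2 <= n)%N.
Proof.
rewrite -!mem_int_range; case: z => r s /=.
by apply/allpairsP/andP => [[[r' s'] [? ? [-> ->]]]|[? ?]]; last by exists (r, s).
Qed.

(* Put N = 4k + 1, x = 4r - 1 and y = 4s - 1: a pair (r, s) with exponent sum k is a
   Gaussian integer x + iy of norm 2N.  Unless 5 divides 2x + y, it is, up to a
   rotation by a power of i, (1 + i)(10(n + im) - (3 + i)) / (3 + i) for a unique
   (n, m); the residue of 2r + s modulo 5 tells which rotation. *)
Definition gauss_map (z : int * int) : int * int :=
  let: (r, s) := z in
  let j := ((2 * r + s) %/ 5)%Z in
  let c := ((2 * r + s) %% 5)%Z in
  if c == 0 then (2 * j, 4 * j - 2 * r)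
  else if c == 1 then (4 * j + 1 - 2 * r, - 2 * j)
  else if c == 3 then (2 * r - 4 * j - 2, 2 * j + 1)
  else (- 2 * j - 1, 2 * r - 4 * j - 3).

(** Since 2x + y = 4(2r + s) - 3, this says that 5 divides 2x + y, that is, 2 + i divides x + iy. *)
Definition ramified (z : int * int) : bool := ((2 * z.1 + z.2) %% 5)%Z == 2.

Lemma theta4E r : (theta_exp 4 1 r)%:Z = 2 * r * r - r.
Proof. by have := @theta_expE 4 1 r isT; lia. Qed.

Lemma theta51E r : 2 * (theta_exp 5 1 r)%:Z = 5 * r * r - 3 * r.
Proof. by rewrite theta_expE //; ring. Qed.

Lemma theta52E r : 2 * (theta_exp 5 2 r)%:Z = 5 * r * r - r.
Proof. by rewrite theta_expE //; ring. Qed.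

Lemma gauss_map_exp z : ~~ ramified z ->
  (theta_exp 5 1 (gauss_map z).1 + theta_exp 5 2 (gauss_map z).2 =
   theta_exp 4 1 z.1 + theta_exp 4 1 z.2)%N.
Proof.
case: z => r s; rewrite /ramified /gauss_map /= => ns.
set j := (_ %/ _)%Z; set c := (_ %% _)%Z in ns *.
have sE : s = 5 * j + c - 2 * r by rewrite /j /c; lia.
have c5 : 0 <= c < 5 by rewrite /c; lia.
move: j c ns sE c5 => j c ns -> c5 {s}.
suff : forall n m : int,
   5 * n * n - 3 * n + (5 * m * m - m) =
   2 * (2 * r * r - r + (2 * (5 * j + c - 2 * r) * (5 * j + c - 2 * r)
     - (5 * j + c - 2 * r))) ->
   (theta_exp 5 1 n + theta_exp 5 2 m =
    theta_exp 4 1 r + theta_exp 4 1 (5 * j + c - 2 * r))%N.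
  move=> H; case: ifP => [/eqP c0|c0]; last case: ifP => [/eqP c1|c1];
    last case: ifP => [/eqP c3|c3]; apply: H => /=.
  - by rewrite c0; ring.
  - by rewrite c1; ring.
  - by rewrite c3; ring.
  - have -> : c = 4 by lia.
    ring.
move=> n m E; have := theta51E n; have := theta52E m; have := theta4E r.
have := theta4E (5 * j + c - 2 * r); lia.
Qed.

(** The parities of the two coordinates of [gauss_map] tell which residue of 2r + s occurred, and
    each branch is linear and invertible. As k <= n, the box holds all solutions. *)
Lemma count_unramified k n : (k <= n)%N ->
  count (predI (fun z => theta_exp 4 1 z.1 + theta_exp 4 1 z.2 == k)%N
               (predC ramified)) (int_box n) =
  count (fun z => theta_exp 5 1 z.1 + theta_exp 5 2 z.2 == k)%N (int_box n).
Proof.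
move=> kn; apply: (@count_bij _ _ _ _ _ _ gauss_map); rewrite ?int_box_uniq //.
- move=> z _ /andP /= [/eqP zk /gauss_map_exp gz].
  rewrite gz zk eqxx andbT mem_int_box.
  have := @theta_exp_ge 5 1 (gauss_map z).1 isT.
  by have := @theta_exp_ge 5 2 (gauss_map z).2 isT; lia.
- move=> [r s] [r' s'] /andP [_ /= ns] /andP [_ /= ns'].
  move: ns ns'; rewrite /ramified /=; do 8?[case: eqP => ? //=] => _ _ [] *; congr pair; lia.
move=> [a b] _ /= /eqP abk.
suff [z nz gz] : exists2 z, ~~ ramified z & gauss_map z = (a, b).
  have := gauss_map_exp nz; rewrite gz /= abk => zk.
  exists z; split=> //; last by rewrite /= -zk eqxx.
  rewrite mem_int_box.
  by have := @theta_exp_ge 4 1 z.1 isT; have := @theta_exp_ge 4 1 z.2 isT; lia.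
have sol (r j c : int) : 0 <= c < 5 -> c != 2 ->
    gauss_map (r, 5 * j + c - 2 * r) =
      (if c == 0 then (2 * j, 4 * j - 2 * r)
       else if c == 1 then (4 * j + 1 - 2 * r, - 2 * j)
       else if c == 3 then (2 * r - 4 * j - 2, 2 * j + 1)
       else (- 2 * j - 1, 2 * r - 4 * j - 3)) /\
    ~~ ramified (r, 5 * j + c - 2 * r).
  move=> c5 c2; rewrite /ramified /gauss_map /=.
  have -> : ((2 * r + (5 * j + c - 2 * r)) %/ 5)%Z = j by lia.
  by have -> : ((2 * r + (5 * j + c - 2 * r)) %% 5)%Z = c by lia.
have [[i [l [-> ->]]]|[i [l [-> ->]]]|[i [l [-> ->]]]|[i [l [-> ->]]]] :
  [\/ exists i l, a = 2 * i /\ b = 2 * l, exists i l, a = 2 * i + 1 /\ b = 2 * l,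
      exists i l, a = 2 * i /\ b = 2 * l + 1 |
      exists i l, a = 2 * i + 1 /\ b = 2 * l + 1].
- have : (a %% 2)%Z = 0 \/ (a %% 2)%Z = 1 by lia.
  have : (b %% 2)%Z = 0 \/ (b %% 2)%Z = 1 by lia.
  move=> [] hb [] ha; [constructor 1|constructor 2|constructor 3|constructor 4];
  by exists (a %/ 2)%Z, (b %/ 2)%Z; split; lia.
(* The arguments solve the linear formulas of the branch with the given parities for r and the
   quotient j. *)
- have [E N] := sol (2 * i - l) i 0 isT isT.
  by eexists; [exact: N|rewrite E /=; congr pair; ring].
- have [E N] := sol (- 2 * l - i) (- l) 1 isT isT.
  by eexists; [exact: N|rewrite E /=; congr pair; ring].
- have [E N] := sol (i + 2 * l + 1) l 3 isT isT.
  by eexists; [exact: N|rewrite E /=; congr pair; ring].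
- have [E N] := sol (l - 2 * i) (- i - 1) 4 isT isT.
  by eexists; [exact: N|rewrite E /=; congr pair; ring].
Qed.

(** The bijection is multiplication of x + iy by -1 + 2i = i(2 + i). It multiplies the norm 8k + 2
    by 5, so k becomes 5k + 1. *)
Lemma count_ramified k n : (k <= n)%N ->
  count (predI (fun z => theta_exp 4 1 z.1 + theta_exp 4 1 z.2 == k)%N
               ramified) (int_box n) =
  count (fun z => (5 * theta_exp 4 1 z.1 + 5 * theta_exp 4 1 z.2).+1 == k)%N
        (int_box n).
Proof.
move=> kn; symmetry.
apply: (@count_bij _ _ _ _ _ _ (fun z => (1 - z.1 - 2 * z.2, 2 * z.1 - z.2)));
  rewrite ?int_box_uniq //.
- move=> [r s] _ /= /eqP rsk.
  have := theta4E r; have := theta4E s; have := theta4E (1 - r - 2 * s).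
  have := theta4E (2 * r - s).
  have := @theta_exp_ge 4 1 (1 - r - 2 * s) isT.
  have := @theta_exp_ge 4 1 (2 * r - s) isT.
  rewrite mem_int_box /= /ramified /=.
  move: (theta_exp _ _ _) (theta_exp _ _ _) => A B geA geB EA EB Es Er.
  have AB : (A + B = k)%N.
    by move: EA EB Es Er; rewrite -rsk; lia.
  by rewrite AB eqxx; lia.
- by move=> [r s] [r' s'] _ _ [] *; congr pair; lia.
move=> [a b] _ /= /andP [/eqP abk]; rewrite /ramified /= => /eqP ab2.
have [j bE] : exists j : int, b = 5 * j + 2 - 2 * a.
  by exists ((2 * a + b) %/ 5)%Z; lia.
have H : ((5 * theta_exp 4 1 (2 * j + 1 - a) + 5 * theta_exp 4 1 (- j)).+1 = k)%N.
  have := theta4E a; have := theta4E b; have := theta4E (2 * j + 1 - a).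
  by have := theta4E (- j); rewrite -abk bE; lia.
exists (2 * j + 1 - a, - j); split; rewrite /= ?H ?eqxx //.
  have := @theta_exp_ge 4 1 (2 * j + 1 - a) isT.
  by have := @theta_exp_ge 4 1 (- j) isT; rewrite mem_int_box /=; lia.
by rewrite bE; congr pair; ring.
Qed.

End Counting.

(** * The identity f_1 f_5 = f_1^6 + X f_5^6 *)

Section ModTwoIdentity.
Local Open Scope ring_scope.
Notation polyF2 := {poly 'F_2}.
Variable K : nat.
Let P : polyF2 := qfact 'X K.
Let P5 : polyF2 := qfact 'X^5 K.

(** Coefficients count pairs: the unramified ones give the first term, the ramified ones the
    second. *)
Lemma theta_identity :
  eqmodX K (theta 'F_2 K 4 1 ^+ 2)
   (theta 'F_2 K 5 1 * theta 'F_2 K 5 2 + 'X * (theta 'F_2 K 4 1 \Po 'X^5) ^+ 2).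
Proof.
move=> k kK; rewrite expr2 coefD coef_pair_sum (count_split _ ramified).
rewrite -/(int_box K) count_unramified ?count_ramified 1?ltnW //.
rewrite natrD addrC coef_pair_sum; congr (_ + _).
have -> : theta 'F_2 K 4 1 \Po 'X^5 = \sum_(r <- int_range K) 'X^(5 * theta_exp 4 1 r).
  by rewrite rmorph_sum /=; apply: eq_bigr => r _; rewrite comp_Xn_poly -exprM.
rewrite coefXM expr2 coef_pair_sum; case: k {kK} => [|k] /=; last by congr _%:R; apply: eq_count.
by rewrite (eq_count (a2 := pred0)) ?count_pred0.
Qed.

Lemma euler_product_identity : eqmodX K (P * P5) (P ^+ 6 + 'X * P5 ^+ 6).
Proof.
have P3 := @jacobi_theta K; rewrite -/P in P3.
have P53 : eqmodX K (P5 ^+ 3) (theta 'F_2 K 4 1 \Po 'X^5).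
  by rewrite /P5 -qfact_comp // -rmorphXn; apply: eqmodX_comp.
have H := eqmodXM (@eqmodX_refl _ K 'X) (eqmodXX 2 P53).
have : eqmodX K (P * P5 + 'X * P5 ^+ 6) (P ^+ 6).
  rewrite (exprM P 3 2) (exprM P5 3 2).
  apply: eqmodX_trans (eqmodXD (@theta5_product K) H) _.
  apply: eqmodX_trans (eqmodX_sym theta_identity) _.
  exact: eqmodXX (eqmodX_sym P3).
(* In characteristic 2, adding the term again moves it to the other side. *)
move=> /eqmodXD /(_ (@eqmodX_refl _ K ('X * P5 ^+ 6))).
by rewrite -addrA -[X in _ + (X + _)]oppF2 addNr addr0.
Qed.
End ModTwoIdentity.

(** * The generating function of regular partitions *)

Section PartitionSeries.
Local Open Scope ring_scope.
Variables (R : comNzRingType) (ell : nat).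

(** Parts and multiplicities are cut at n, which leaves the coefficients up to X^n exact. The index
    0 drops out because [ell] divides it. *)
Definition part_series n : {poly R} :=
  \prod_(i < n.+1 | ~~ (ell %| i)%N) \sum_(j < n.+1) 'X^(i * j).

Lemma coef_part_series n : (part_series n)`_n = (b ell n)%:R.
Proof.
(* Forbidden parts get the indicator of multiplicity 0, so that expanding the product ranges over
   all functions [m] of the definition of [b]. *)
pose F (i j : 'I_n.+1) : {poly R} :=
  if (ell %| i)%N then (j == ord0)%:R else 'X^(i * j).
have -> : part_series n = \prod_i \sum_j F i j.
  rewrite /part_series big_mkcond; apply: eq_bigr => i _ /=.
  rewrite /F; case: (ell %| i)%N => //=; rewrite (bigD1 ord0) //= big1 ?addr0 //.
  by move=> j /negbTE ->.
rewrite bigA_distr_bigA coef_sum /b -sum1_card natr_sum [RHS]big_mkcond.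
apply: eq_bigr => f _; rewrite inE; case: (boolP [forall i, _]) => [/forallP H|].
  have -> : \prod_i F i (f i) = 'X^(\sum_(i < n.+1) i * f i).
    rewrite expr_sum; apply: eq_bigr => i _; rewrite /F; case: ifP => // li.
    by have := H i; rewrite li /= => /eqP ->; rewrite muln0 eqxx.
  by rewrite coefXn andbT eq_sym; case: eqP.
rewrite andbF negb_forall => /existsP [i]; rewrite negb_imply => /andP [li fi].
by rewrite (bigD1 i) //= /F li (negbTE fi) mul0r coef0.
Qed.

Lemma qfact_part n : (0 < ell)%N ->
  (\prod_(i < n.+1 | ~~ (ell %| i)%N) (1 - 'X^i)) * qfact 'X^ell (n %/ ell) =
  qfact 'X n :> {poly R}.
Proof.
move=> l0; elim: n => [|n IH].
  by rewrite div0n /qfact !big_ord0 big_mkcond big_ord1 /= dvdn0 mulr1.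
rewrite big_mkcond big_ord_recr -big_mkcond /= qfactS -IH divnS //.
case: (boolP (ell %| n.+1)%N) => [ln|_]; last by rewrite add0n mulrAC.
rewrite add1n qfactS mulr1 mulrA; congr (_ * (1 - _)).
by rewrite -exprM; congr ('X^_); rewrite -[in RHS](divnK ln) divnS // ln mulnC.
Qed.

(** Multiplied by 1 - X^i, each geometric sum telescopes to 1 - X^(i(n+1)), which is 1 to this
    precision as i > 0. *)
Lemma part_series_qfact n : (0 < ell)%N ->
  eqmodX n.+1 (part_series n * qfact 'X n.+1) (qfact 'X^ell n.+1).
Proof.
move=> l0; apply: (@eqmodX_trans _ _ (part_series n * qfact 'X n)).
  by apply: eqmodXM => //; rewrite -['X]expr1; apply: qfact_stable; lia.
rewrite -qfact_part // mulrA -[X in eqmodX _ _ X]mul1r; apply: eqmodXM; last first.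
  by apply: qfact_stable; [rewrite mulnC; exact: ltn_ceil|nia].
apply: (@eqmodX_trans _ _ (\prod_(i < n.+1 | ~~ (ell %| i)%N) 1)); last by rewrite big1.
rewrite /part_series -big_split /=; apply: eqmodX_prod => i li.
have i0 : (0 < i)%N by case: (posnP i) li => // ->; rewrite dvdn0.
have -> : (\sum_(j < n.+1) 'X^(i * j)) * (1 - 'X^i) = 1 - 'X^(i * n.+1) :> {poly R}.
  move: (nat_of_ord i) => d; elim: n.+1 => [|m IH]; first by rewrite big_ord0 muln0 expr0 subrr mul0r.
  by rewrite big_ord_recr mulrDl IH /= mulnS exprD; ring.
by apply: eqmodX_subXn; nia.
Qed.

End PartitionSeries.

(** * The coefficients of index 4M + 1 *)

Section Quadrisection.
Local Open Scope ring_scope.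
Notation polyF2 := {poly 'F_2}.

(** Writing P5^6 as P5^4 (G P)^2 and cancelling P^2 gives [H]; the claim is [H] substituted into its
    own G^2, squaring being additive. *)
Lemma part_series5_mod2 K (G P P5 : polyF2) : P`_0 = 1 ->
  eqmodX K (G * P) P5 -> eqmodX K (P * P5) (P ^+ 6 + 'X * P5 ^+ 6) ->
  eqmodX K G (P ^+ 4 + 'X * (P5 * P ^+ 2) ^+ 4 + 'X^3 * (P5 ^+ 3 * G) ^+ 4).
Proof.
move=> P0 GP E.
have H : eqmodX K G (P ^+ 4 + 'X * (P5 ^+ 4 * G ^+ 2)).
  apply: (@eqmodX_cancel _ _ P) => //; apply: (@eqmodX_cancel _ _ P) => //.
  apply: (@eqmodX_trans _ _ (P5 * P)); first by apply: eqmodXM.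
  rewrite mulrC; apply: eqmodX_trans E _.
  have -> : (P ^+ 4 + 'X * (P5 ^+ 4 * G ^+ 2)) * P * P =
            P ^+ 6 + 'X * (P5 ^+ 4 * (G * P) ^+ 2) by ring.
  apply: eqmodXD => //; apply: eqmodXM => //.
  rewrite (exprD P5 4 2); apply: eqmodXM => //.
  by apply: eqmodXX; apply: eqmodX_sym.
have H2 := eqmodXX 2 H.
apply: eqmodX_trans H _.
have -> : P ^+ 4 + 'X * (P5 * P ^+ 2) ^+ 4 + 'X^3 * (P5 ^+ 3 * G) ^+ 4 =
  P ^+ 4 + 'X * (P5 ^+ 4 * (P ^+ 4 + 'X * (P5 ^+ 4 * G ^+ 2)) ^+ 2).
  rewrite -(pFrobenius_autE pcharF2 (P ^+ 4 + _)) pFrobenius_autD_comm; last exact: mulrC.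
  by rewrite !pFrobenius_autE; ring.
by apply: eqmodXD => //; apply: eqmodXM => //; apply: eqmodXM.
Qed.

(** Fourth powers are polynomials in X^4, so the three terms live in exponents 0, 1 and 3 modulo 4,
    and only the middle one reaches 4M + 1. *)
Lemma b5_quadrisection M (K := (4 * M + 1).+1) :
  (b 5 (4 * M + 1))%:R = (qfact 'X^5 K * qfact 'X K ^+ 2 : polyF2)`_M.
Proof.
rewrite -coef_part_series.
have P0 : (qfact 'X K : polyF2)`_0 = 1 by rewrite -['X]expr1; apply: qfact_coef0.
have GP := @part_series_qfact 'F_2 5 (4 * M + 1) isT.
rewrite (part_series5_mod2 P0 GP (@euler_product_identity K)) //.
move: (part_series _ _ _) (qfact 'X K) (qfact 'X^5 K) {P0 GP} => G P P5.
rewrite (expF2_4 P) (expF2_4 (P5 * _)) (expF2_4 (_ * G)).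
rewrite !coefD coefXM coefXnM !coef_comp_poly_Xn // addn1 /=.
have -> : (4 %| (4 * M).+1)%N = false by lia.
have -> : (4 %| 4 * M)%N by lia.
have -> : ((4 * M).+1 - 3 = 4 * M - 2)%N by lia.
(* The guard excludes M = 0, where the subtraction truncates to 0. *)
have M2 : (2 <= 4 * M)%N -> (4 %| 4 * M - 2)%N = false by lia.
rewrite add0r mulKn //; case: ltnP => [_|/M2 ->]; exact: addr0.
Qed.

(** Completing the square: 24 (3r^2 - r)/2 + 1 = (6r - 1)^2. *)
Lemma theta3_form M (r s : int) :
  (5 * theta_exp 3 1 s + 2 * theta_exp 3 1 r = M)%N ->
  2 * (6 * r - 1) ^+ 2 + 5 * (6 * s - 1) ^+ 2 = (24 * M + 7)%N.
Proof.
move=> <-; have := @theta_expE 3 1 r isT; have := @theta_expE 3 1 s isT; lia.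
Qed.

Lemma odd_b5_rep M : odd (b 5 (4 * M + 1)) ->
  exists x y : int, 2 * x ^+ 2 + 5 * y ^+ 2 = (24 * M + 7)%N.
Proof.
move=> bodd; pose K := (4 * M + 1).+1.
have : (b 5 (4 * M + 1))%:R != 0 :> 'F_2.
  by rewrite -(dvdn_pcharf (pchar_Fp (isT : prime 2))) dvdn2 bodd.
(* Now f_5 f_1^2 = f_5 f_2, and both factors are pentagonal series in a power of X. *)
rewrite b5_quadrisection sqrF2 -(qfact_comp _ _ (isT : 0 < 5)%N) -/K.
have E d : (0 < d)%N -> eqmodX K (qfact ('X : polyF2) K \Po 'X^d)
    (\sum_(r <- int_range K) 'X^(d * theta_exp 3 1 r)).
  move=> d0; apply: (eqmodX_trans (eqmodX_comp d0 (@euler_theta K))).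
  rewrite rmorph_sum /=; under eq_bigr => r _ do rewrite comp_Xn_poly -exprM.
  exact: eqmodX_refl.
rewrite (eqmodXM (E 5 isT) (E 2 isT)); last by rewrite /K; lia.
rewrite coef_pair_sum; case: (boolP (has (fun z => 5 * theta_exp 3 1 z.1 +
   2 * theta_exp 3 1 z.2 == M)%N (int_box K))); last first.
  by rewrite has_count -leqNgt leqn0 => /eqP ->; rewrite eqxx.
case/hasP => z _ /eqP zM _.
by exists (6 * z.2 - 1), (6 * z.1 - 1); apply: theta3_form zM.
Qed.

End Quadrisection.

(** * Divisibility of 2x^2 + 5y^2 by p *)

Section QuadraticForm.
Local Open Scope ring_scope.
Variable p : nat.
Hypothesis p_pr : prime p.
Hypothesis leg : legendre (-10) p = -1.

(** [legendre] looks for roots only below p, so z is first reduced modulo p. *)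
Lemma legendre_nonresidue (z : int) : ~~ (p%:Z %| z ^+ 2 + 10)%Z.
Proof.
apply/negP => pz; move: leg; rewrite /legendre; case: ifP => // _.
have p0 : (0 < p)%N := prime_gt0 p_pr.
have zp : (absz (z %% p)%Z < p)%N by have := @ltz_mod z p; have := @modz_ge0 z p; lia.
case: ifP => // /negbT; rewrite negb_exists => /forallP /(_ (Ordinal zp)) /negP [] /=.
rewrite opprK gez0_abs; last by apply: modz_ge0; lia.
have -> : (z %% p)%Z ^+ 2 + 10 = z ^+ 2 + 10 - p%:Z * ((z %/ p)%Z * (z + (z %% p)%Z)).
  by move: (divz_eq z p); move: (z %/ p)%Z (z %% p)%Z => q m ->; ring.
by rewrite rpredB // dvdz_mulr.
Qed.

Lemma dvd_form (x y : int) : (p%:Z %| 2 * x ^+ 2 + 5 * y ^+ 2)%Z ->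
  (p%:Z %| x)%Z && (p%:Z %| y)%Z.
Proof.
move=> pxy.
(* The nonresidue property at z = 0. *)
have p10 : ~~ (p %| 10)%N.
  by apply: contra (legendre_nonresidue 0) => ?; rewrite expr0n add0r dvdzE.
have py : (p%:Z %| y)%Z.
  apply/negPn/negP => npy.
  have : coprimez y p by rewrite coprimezE coprime_sym prime_coprime.
  (* With u inverse to y modulo p, 2x^2 = -5y^2 makes 2xu a square root of -10. *)
  case/coprimezP => [[u v]] /= uv; have := legendre_nonresidue (2 * x * u).
  have uyE : u * y = 1 - v * p%:Z by rewrite -uv; ring.
  have -> : (2 * x * u) ^+ 2 + 10 = 2 * u ^+ 2 * (2 * x ^+ 2 + 5 * y ^+ 2)
     + 10 * (1 - (u * y) ^+ 2) by ring.
  have -> : 1 - (u * y) ^+ 2 = (2 * v - v ^+ 2 * p%:Z) * p%:Z by rewrite uyE; ring.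
  by rewrite rpredD ?(dvdz_mull _ pxy) // mulrA dvdz_mull.
rewrite py andbT.
have : (p%:Z %| 2 * x ^+ 2)%Z.
  have py2 : (p%:Z %| 5 * y ^+ 2)%Z by rewrite expr2 !dvdz_mull.
  by rewrite -(rpredDr _ py2).
rewrite !dvdzE abszM abszX Euclid_dvdM // Euclid_dvdX // => /orP [p2|/andP [//]].
by rewrite (dvdn_trans p2) in p10.
Qed.

(** Descent: p divides x and y, so p^2 comes out of the form and a drops by one; at a = 0 the spare
    p must divide w. *)
Lemma form_valuation a (x y w : int) :
  2 * x ^+ 2 + 5 * y ^+ 2 = p%:Z ^+ (2 * a + 1) * w -> (p%:Z %| w)%Z.
Proof.
have p0 : p%:Z != 0 by have := prime_gt0 p_pr; lia.
elim: a x y => [|a IH] x y E.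
all: have /dvd_form /andP [/dvdzP [x' xE] /dvdzP [y' yE]] :
  (p%:Z %| 2 * x ^+ 2 + 5 * y ^+ 2)%Z by rewrite E addn1 exprS -mulrA dvdz_mulr.
  apply/dvdzP; exists (2 * x' ^+ 2 + 5 * y' ^+ 2); apply: (mulfI p0).
  by rewrite -[p%:Z in LHS]expr1 -[LHS]E xE yE; ring.
apply: (IH x' y'); apply: (mulfI (expf_neq0 2 p0)).
rewrite [RHS]mulrA -exprD; have -> : (2 + (2 * a + 1) = 2 * a.+1 + 1)%N by lia.
by rewrite -E xE yE; ring.
Qed.

End QuadraticForm.

(** * The arithmetic progression *)

(** Every unit modulo 24 has square 1. *)
Lemma sqr_mod24 p : prime p -> (5 <= p)%N -> exists k, (p ^ 2 = 24 * k + 1)%N.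
Proof.
move=> pp p5; exists (p ^ 2 %/ 24)%N.
have p2 : ~~ (2 %| p)%N by rewrite dvdn_prime2 //; lia.
have p3 : ~~ (3 %| p)%N by rewrite dvdn_prime2 //; lia.
rewrite [LHS](divn_eq _ 24) mulnC; congr (_ + _)%N.
rewrite -modnXm; have : (p %% 24 < 24)%N by rewrite ltn_mod.
have : ~~ (2 %| p %% 24)%N by lia.
have : ~~ (3 %| p %% 24)%N by lia.
by move: (p %% 24)%N; do 24?[case=> //].
Qed.

Theorem theorem3p17 (p : nat) :
  prime p -> (5 <= p)%N -> legendre (-10)%R p = (-1)%R ->
  forall (alpha n i : nat), (1 <= alpha)%N -> (1 <= i <= p.-1)%N ->
  b 5 (4 * p ^ (2 * alpha) * n
       + ((24 * i + 7 * p) * p ^ (2 * alpha - 1) - 1) %/ 6) = 0 %[mod 2].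
Proof.
move=> pp p5 leg [//|a] n i _ ip.
have -> : 2 * a.+1 - 1 = 2 * a + 1 by lia.
have -> : 2 * a.+1 = (2 * a + 1).+1 by lia.
have [k pk] : exists k, p ^ (2 * a + 1).+1 = 24 * k + 1.
  have -> : (2 * a + 1).+1 = 2 * a.+1 by lia.
  have [l lE] := sqr_mod24 pp p5; rewrite expnM lE.
  elim: a.+1 => [|m [k kE]]; first by exists 0.
  by exists (k * (24 * l + 1) + l); rewrite expnSr kE; ring.
(* Chosen so that the index is 4M + 1; [pk] makes the division by 6 exact. *)
pose M := p ^ (2 * a + 1).+1 * n + i * p ^ (2 * a + 1) + 7 * k.
have -> : 4 * p ^ (2 * a + 1).+1 * n +
          ((24 * i + 7 * p) * p ^ (2 * a + 1) - 1) %/ 6 = 4 * M + 1.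
  have -> : (24 * i + 7 * p) * p ^ (2 * a + 1) - 1 =
            (4 * (i * p ^ (2 * a + 1) + 7 * k) + 1) * 6.
    rewrite mulnDl -[7 * p * _]mulnA -expnS pk -mulnA; lia.
  by rewrite mulnK // /M; ring.
apply/eqP; rewrite mod0n modn2 eqb0; apply/negP => /odd_b5_rep [x [y E]].
have /(form_valuation pp leg) : (2 * x ^+ 2 + 5 * y ^+ 2 =
    p%:Z ^+ (2 * a + 1) * (24 * p * n + 24 * i + 7 * p)%N)%R.
  rewrite E -[Posz p]natz -natrX natz -PoszM; congr Posz.
  have -> : 24 * M + 7 = 24 * (p ^ (2 * a + 1).+1 * n) + 24 * (i * p ^ (2 * a + 1))
    + 7 * p ^ (2 * a + 1).+1 by rewrite /M pk; ring.
  by rewrite expnS; ring.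
(* Modulo p the cofactor is 24i, which is nonzero because 0 < i < p and p >= 5. *)
rewrite dvdzE /= addnAC -mulnA [24 * (p * n)]mulnCA dvdn_addr.
  rewrite Euclid_dvdM // => /orP [p24|]; last by apply/negP; rewrite gtnNdvd; lia.
  move: p24; rewrite -[24]/(2 ^ 3 * 3) Euclid_dvdM // Euclid_dvdX // !dvdn_prime2 //; lia.
by rewrite dvdn_add ?(dvdn_mulr _ (dvdnn p)) ?(dvdn_mull _ (dvdnn p)).
Qed.
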